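(* Let $P=C_2\times C_2\times C_2$ be the product of three two-element chains (with the componentwise order). Then the probability functions polytope $\mathcal{Q}_P\subset\mathbb{R}^{\mathcal{A}(P)}\cong\mathbb{R}^{18}$ has $77$ vertices, and exactly one of them does not have all coordinates in $\{0,1\}$, namely $\tfrac12\mathbf{1}$ (all coordinates equal to $\tfrac12$), which corresponds to the probability function $\mathrm{nu}$ with $\mathrm{nu}(x,y)=1$ if $x<y$, $\mathrm{nu}(x,y)=\tfrac12$ if $x\parallel y$, and $\mathrm{nu}(x,y)=0$ if $x>y$. Consequently $\mathcal{Q}_P$ is not a $0/1$-polytope and not a lattice polytope.
   Context: For $x,y$ in a poset $(P,\le)$, $x\parallel y$ means that neither $x\le y$ nor $y\le x$. A probability function on $P$ is a function $\pi:\{(x,y)\in P\times P\mid x\ne y\}\to[0,1]$ such that, for all $x,y,z\in P$ for which the values involved are defined: (1) $x\le y$ implies $\pi(x,y)=1$; (2) $x\neq y$ implies $\pi(x,y)+\pi(y,x)=1$; (3) $y<z$ implies $\pi(x,y)\le\pi(x,z)$; (4) $y<z$ implies $\pi(z,x)\le\pi(y,x)$. Put $\mathcal{A}(P)=\{(x,y)\in P\times P\mid x\parallel y\}$. The probability functions polytope $\mathcal{Q}_P\subset\mathbb{R}^{\mathcal{A}(P)}$ is the set of all restrictions $\pi|_{\mathcal{A}(P)}$ of probability functions $\pi$ on $P$; it is a convex polytope. A $0/1$-polytope is a polytope all of whose vertices have coordinates in $\{0,1\}$; a lattice polytope is one all of whose vertices have integer coordinates. *)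

(* Defs.v *)
(* MathComp world, over an arbitrary [R : realType]. *)
From HB Require Import structures.
From mathcomp Require Import all_boot all_order all_algebra.
From mathcomp Require Import boolp classical_sets functions cardinality reals.

Set Implicit Arguments.
Unset Strict Implicit.
Unset Printing Implicit Defensive.

Import Order.TTheory GRing.Theory Num.Theory.

Local Open Scope classical_set_scope.
Local Open Scope ring_scope.

Section ConvexPolytopes.
Variables (R : realType) (I : finType).

(* R^I is {ffun I -> R}. *)

Definition convex_hull n (p : 'I_n -> {ffun I -> R}) : set {ffun I -> R} :=
  [set x | exists w : 'I_n -> R,
     [/\ forall k, 0 <= w k, \sum_k w k = 1
       & x = [ffun i => \sum_k w k * p k i]]].

Definition is_polytope (Q : set {ffun I -> R}) : Prop :=
  exists n (p : 'I_n -> {ffun I -> R}), Q = convex_hull p.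

Definition dotp (c x : {ffun I -> R}) : R := \sum_i c i * x i.

(* A face is cut out by an inequality [dotp c x <= b] valid on Q;
   a vertex is a zero-dimensional face. *)
Definition is_face (Q F : set {ffun I -> R}) : Prop :=
  exists (c : {ffun I -> R}) (b : R),
    (forall x, Q x -> dotp c x <= b) /\ F = [set x | Q x /\ dotp c x = b].

Definition vertices (Q : set {ffun I -> R}) : set {ffun I -> R} :=
  [set v | is_face Q [set v]].

Definition zero_one_point (v : {ffun I -> R}) : Prop :=
  forall i, v i = 0 \/ v i = 1.

Definition zero_one_polytope (Q : set {ffun I -> R}) : Prop :=
  is_polytope Q /\ forall v, vertices Q v -> zero_one_point v.

Definition lattice_polytope (Q : set {ffun I -> R}) : Prop :=
  is_polytope Q /\ forall v, vertices Q v -> forall i, v i \is a Num.int.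

End ConvexPolytopes.

Section ProbabilityFunctions.
Variables (R : realType) (d : Order.disp_t) (P : finPOrderType d).

(* A function on {(x, y) | x != y} is represented in curried form; it cannot
   depend on the proof of [x != y], since boolean proofs are irrelevant. *)
Definition offdiag_fun := forall x y : P, x != y -> R.

Record is_probability_function (pi : offdiag_fun) : Prop := {
  prob_itv : forall x y (xy : x != y), 0 <= pi x y xy <= 1;
  prob_le : forall x y (xy : x != y), (x <= y)%O -> pi x y xy = 1;
  prob_compl : forall x y (xy : x != y) (yx : y != x),
    pi x y xy + pi y x yx = 1;
  prob_monor : forall x y z (xy : x != y) (xz : x != z),
    (y < z)%O -> pi x y xy <= pi x z xz;
  prob_monol : forall x y z (zx : z != x) (yx : y != x),
    (y < z)%O -> pi z x zx <= pi y x yx }.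

(* [x >< y] is the library's incomparability, ~~ ((x <= y) || (y <= x)). *)
Definition incomp : Type := {p : P * P | (p.1 >< p.2)%O}.
HB.instance Definition _ := Finite.on incomp.

Lemma incomp_neq (a : incomp) : (sval a).1 != (sval a).2.
Proof. by rewrite (incomparable_eqF (svalP a)). Qed.

Definition restrict_incomp (pi : offdiag_fun) : {ffun incomp -> R} :=
  [ffun a => pi (sval a).1 (sval a).2 (incomp_neq a)].

Definition prob_polytope : set {ffun incomp -> R} :=
  [set restrict_incomp pi | pi in [set pi | is_probability_function pi]].

Definition nu : offdiag_fun := fun x y _ =>
  if (x < y)%O then 1 else if (y < x)%O then 0 else 2^-1.

Definition half_point : {ffun incomp -> R} := [ffun=> 2^-1].

End ProbabilityFunctions.

Arguments prob_polytope R {d} P.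
Arguments nu R {d} P.
Arguments half_point R {d} P.

(* The two-element chain is [bool], with false < true; [*p] is the product
   with the componentwise order. *)
Notation C2 := bool (only parsing).
Notation C2C2C2 := ((C2 *p C2) *p C2)%type.

(* Main.v *)
(** Write [a_i] for the atoms and [c_i] for the coatom incomparable to [a_i],
    indices in Z/3. A probability function on the cube is determined by
    [w_i = pi(a_i, c_i)] and, for each [m], the two numbers
    [pi(a_(m+1), a_(m+2))] and [pi(c_(m+2), c_(m+1))]; the axioms say exactly that
    [w_i <= 1] and that both numbers lie in the interval [[1 - w_(m+2), w_(m+1)]].
    The polytope of the [w]'s ([w_i <= 1], [w_i + w_j >= 1]) is the hull of
    [(1,1,1)], its three neighbours with one coordinate 0, and [(1/2,1/2,1/2)].
    The endpoints of the intervals are affine in [w], so a decomposition of [w]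
    lifts, the positions within the six intervals being decomposed by product
    weights on [{0,1}^6]. This gives 64 vertices above [(1,1,1)], 4 above each
    neighbour (where only one interval does not degenerate to a point), and 1
    above [(1/2,1/2,1/2)]. The 0/1 points are exposed because the polytope lies in
    the unit cube, and the half point because it minimises [w_0 + w_1 + w_2]. *)
Require Import Defs.
From mathcomp Require Import all_boot all_order all_algebra.
From mathcomp Require Import boolp classical_sets functions cardinality reals.
From mathcomp Require Import ring lra zify.

Import Order.TTheory GRing.Theory Num.Theory.

Local Open Scope classical_set_scope.
Local Open Scope ring_scope.

(** * Vertices of finite convex hulls and exposed 0/1 points *)

Lemma convex_hull_enum_valP {R : realType} {I T : finType}
    (f : T -> {ffun I -> R}) (x : {ffun I -> R}) :
  convex_hull (fun k : 'I_#|T| => f (enum_val k)) x <->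
  exists w : T -> R, [/\ forall t, 0 <= w t, \sum_t w t = 1
    & x = [ffun i => \sum_t w t * f t i]].
Proof.
have reind (F : T -> R) : \sum_t F t = \sum_(k < #|T|) F (enum_val k).
  exact: (big_enum_val (A := T) F).
split=> -[w [w_ge0 w1 ->]].
  exists (fun t => w (enum_rank t)); split => //.
    by rewrite reind -[RHS]w1; apply: eq_bigr => k _; rewrite enum_valK.
  by apply/ffunP => i; rewrite !ffunE reind; apply: eq_bigr => k _;
    rewrite enum_valK.
exists (fun k => w (enum_val k)); split => //; first by rewrite -reind.
by apply/ffunP => i; rewrite !ffunE reind.
Qed.

Lemma convex_hull_enum_val_vertex {R : realType} {I T : finType}
    (f : T -> {ffun I -> R}) (t : T) :
  convex_hull (fun k : 'I_#|T| => f (enum_val k)) (f t).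
Proof.
apply/convex_hull_enum_valP; exists (fun u => (u == t)%:R); split => //.
- by rewrite (bigD1 t) //= eqxx big1 ?addr0 // => u /negPf ->.
- apply/ffunP => i; rewrite ffunE (bigD1 t) //= eqxx mul1r big1 ?addr0 //.
  by move=> u /negPf ->; rewrite mul0r.
Qed.

(** The value of a valid functional at [v] is a weighted mean of its values at the generators. When
    it attains the bound, so does every generator of nonzero weight, and the face contains only
    [v]. *)
Lemma vertices_convex_hull_sub {R : realType} {I T : finType}
    (f : T -> {ffun I -> R}) (v : {ffun I -> R}) :
  vertices (convex_hull (fun k : 'I_#|T| => f (enum_val k))) v ->
  exists t, v = f t.
Proof.
move=> [c [b [c_le face]]].
have faceE y : y = v <->
    convex_hull (fun k : 'I_#|T| => f (enum_val k)) y /\ dotp c y = b.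
  by move: (congr1 (fun A => A y) face) => /= <-.
have [Qv cv] := (faceE v).1 erefl.
have [w [w_ge0 w1 vE]] := (convex_hull_enum_valP _ _).1 Qv.
have dot_v : dotp c v = \sum_t w t * dotp c (f t).
  rewrite /dotp vE; under eq_bigr do rewrite ffunE mulr_sumr.
  rewrite exchange_big; apply: eq_bigr => t _; rewrite mulr_sumr.
  by apply: eq_bigr => i _; rewrite mulrCA.
have slack0 : \sum_t w t * (b - dotp c (f t)) = 0.
  under eq_bigr do rewrite mulrBr.
  by rewrite sumrB -mulr_suml w1 mul1r -dot_v cv subrr.
have slack_ge0 t : 0 <= w t * (b - dotp c (f t)).
  by rewrite mulr_ge0 // subr_ge0; apply/c_le/convex_hull_enum_val_vertex.
have [t wt] : exists t, w t != 0.
  apply/existsP; apply: contra_eqT w1 => /existsPn w0.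
  rewrite big1 => [|t _]; first by rewrite eq_sym oner_neq0.
  exact/eqP/negPn/w0.
exists t; apply/esym/faceE; split; first exact: convex_hull_enum_val_vertex.
have /eqP := @psumr_eq0P _ _ predT _ (fun t _ => slack_ge0 t) slack0 t isT.
by rewrite mulf_eq0 (negPf wt) subr_eq0 => /eqP.
Qed.

(** The functional with coefficients [2 * v i - 1], which are 1 or -1, exposes [v]: on the unit cube
    its gap at [x] is the sum of the [|v i - x i|]. *)
Lemma zero_one_vertex {R : realType} {I : finType} (Q : set {ffun I -> R}) v :
  (forall x, Q x -> forall i, 0 <= x i <= 1) -> Q v -> zero_one_point v ->
  vertices Q v.
Proof.
move=> Q01 Qv v01.
have gap_ge0 x i : 0 <= x i <= 1 -> 0 <= v i - (2 * v i - 1) * x i.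
  by case: (v01 i) => ->; lra.
have gapE x : \sum_i v i - dotp [ffun i => 2 * v i - 1] x =
    \sum_i (v i - (2 * v i - 1) * x i).
  by rewrite sumrB; congr (_ - _); apply: eq_bigr => i _; rewrite ffunE.
exists [ffun i => 2 * v i - 1], (\sum_i v i); split.
  move=> x Qx; rewrite -subr_ge0 gapE; apply: sumr_ge0 => i _.
  exact/gap_ge0/Q01.
apply/seteqP; split=> [x ->|x [Qx /eqP]].
  split=> //; apply/eqP; rewrite eq_sym -subr_eq0 gapE; apply/eqP.
  by apply: big1 => i _; case: (v01 i) => ->; ring.
rewrite eq_sym -subr_eq0 gapE => /eqP gap0; apply/ffunP => i.
have := @psumr_eq0P _ _ predT _ (fun i _ => gap_ge0 x i (Q01 x Qx i)) gap0 i isT.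
by case: (v01 i) => ->; lra.
Qed.

(** * Product weights on {0,1}^J *)

(** For [t] with values in [0,1]: the law of independent bits, bit [j] being true with probability
    [t j]. *)
Definition product_weight {R : realType} {J : finType} (t : J -> R)
    (eps : {ffun J -> bool}) : R :=
  \prod_j (if eps j then t j else 1 - t j).

Lemma product_weight_ge0 {R : realType} {J : finType} (t : J -> R) eps :
  (forall j, 0 <= t j <= 1) -> 0 <= product_weight t eps.
Proof.
move=> t01; apply: prodr_ge0 => j _; have /andP[t0 t1] := t01 j.
by case: ifP; rewrite ?subr_ge0.
Qed.

Lemma sum_product_weight {R : realType} {J : finType} (t : J -> R) :
  \sum_eps product_weight t eps = 1.
Proof.
rewrite -(bigA_distr_bigA (fun j (b : bool) => if b then t j else 1 - t j)).
by apply: big1 => j _; rewrite big_bool /= addrC subrK.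
Qed.

Lemma product_weight_marginal {R : realType} {J : finType} (t : J -> R) j0 :
  \sum_eps product_weight t eps * (eps j0)%:R = t j0.
Proof.
(* The indicator of [eps j0] is absorbed into the factor at [j0], so the sum still factors over
   coordinates. *)
pose F j (b : bool) := (if b then t j else 1 - t j) * (b || (j != j0))%:R.
transitivity (\sum_(eps : {ffun J -> bool}) \prod_j F j (eps j)).
  apply: eq_bigr => eps _; rewrite big_split /=; congr (_ * _).
  rewrite (bigD1 j0) //= eqxx orbF big1 ?mulr1 // => j /negPf ->.
  by rewrite orbT.
rewrite -bigA_distr_bigA (bigD1 j0) //= big_bool /F /= eqxx mulr0 addr0 mulr1.
rewrite big1 ?mulr1 // => j /negPf jj0.
by rewrite big_bool /= jj0 !mulr1 addrC subrK.
Qed.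

(** * The probability polytope in terms of incomparable pairs *)

(** Values at comparable pairs are forced, and monotonicity involving them is automatic; left
    monotonicity is recovered from the right one by complementation. *)
Lemma prob_polytopeP {R : realType} (d : Order.disp_t) (P : finPOrderType d)
    (x : {ffun incomp P -> R}) :
  prob_polytope R P x <->
  [/\ forall a, 0 <= x a <= 1,
      forall a b, sval b = ((sval a).2, (sval a).1) -> x a + x b = 1
    & forall a b, (sval a).1 = (sval b).1 -> ((sval a).2 < (sval b).2)%O ->
        x a <= x b].
Proof.
split=> [[pi [itv _ compl monor _] <-]|[itv compl mono]].
  split=> [a|[[p q] pq] [[r s] rs] /= [er es]|
           [[p q] pq] [[r s] rs] /= er qs].
  - by rewrite ffunE.
  - by subst; rewrite !ffunE compl.
  - by subst; rewrite !ffunE monor.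
pose sub (p q : P) : option {pq : P * P | (pq.1 >< pq.2)%O} := insub (p, q).
(* The default 0 is the forced value for [q < p]; it is also taken on the diagonal, outside the
   domain. *)
pose pi (p q : P) : R := if (p < q)%O then 1 else oapp x 0 (sub p q).
have pi_lt p q : (p < q)%O -> pi p q = 1 by rewrite /pi => ->.
have subN p q : (p >=< q)%O -> sub p q = None.
  by move=> pq; rewrite /sub insubF //= pq.
have pi_gt p q : (q < p)%O -> pi p q = 0.
  by move=> qp; rewrite /pi lt_gtF // subN // comparable_sym lt_comparable.
have pi_incomp (p q : P) (pq : (p >< q)%O) : pi p q = x (exist _ (p, q) pq).
  rewrite /pi; case: ifP => [/lt_comparable|_]; first by rewrite (negPf pq).
  by rewrite /sub (@insubT _ (fun pq => pq.1 >< pq.2)%O _ (p, q) pq).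
have pi01 p q : 0 <= pi p q <= 1.
  case: (boolP (p >=< q)%O) => [|pq]; last by rewrite pi_incomp.
  by rewrite /pi; case: ifP => _ pq; rewrite ?subN //= ?ler01 lexx.
have pi_compl p q : p != q -> pi p q + pi q p = 1.
  move=> pq; case: (comparableP p q) pq => [pq|qp|pq|->] //.
  - by rewrite pi_lt // pi_gt // addr0.
  - by rewrite pi_gt // pi_lt // add0r.
  - have qp : (q >< p)%O by rewrite comparable_sym.
    by rewrite (pi_incomp _ _ pq) (pi_incomp _ _ qp)
      (compl (exist _ (p, q) pq) (exist _ (q, p) qp)).
have pi_mono p q r : p != q -> p != r -> (q < r)%O -> pi p q <= pi p r.
  move=> pq pr qr; have /andP[pr0 pr1] := pi01 p r; have /andP[pq0 pq1] := pi01 p q.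
  case: (comparableP p q) pq => [lt_pq|lt_qp|pq|->] //.
  - by rewrite (pi_lt _ _ (lt_trans lt_pq qr)).
  - by rewrite (pi_gt _ _ lt_qp).
  case: (comparableP p r) pr => [lt_pr|lt_rp|pr|->] //.
  - by rewrite (pi_lt _ _ lt_pr).
  - by have := lt_comparable (lt_trans qr lt_rp); rewrite comparable_sym (negPf pq).
  - by rewrite (pi_incomp _ _ pq) (pi_incomp _ _ pr)
      (mono (exist _ (p, q) pq) (exist _ (p, r) pr)).
exists (fun p q _ => pi p q); last first.
  by apply/ffunP => -[[p q] pq]; rewrite ffunE /= (pi_incomp _ _ pq).
split=> //.
- by move=> p q pq le_pq; rewrite pi_lt // lt_neqAle pq.
- by move=> p q pq _; exact: pi_compl.
- move=> p q r rp qp qr.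
  have := pi_mono p q r; rewrite !(eq_sym p) => /(_ qp rp qr).
  by have := pi_compl _ _ rp; have := pi_compl _ _ qp; lra.
Qed.

(** * Coordinates on the cube *)

(* [inl i] is the pair (a_i, c_i); [inr (m, true)] is (a_(m+1), a_(m+2)) and
   [inr (m, false)] is (c_(m+2), c_(m+1)), oriented so that both have the same
   bounds in [edge_polytope]. *)
Notation Edge := ('I_3 + 'I_3 * bool)%type.

Definition atom (i : 'I_3) : C2C2C2 := (i == 0, i == 1, i == 2%:R).
Definition coatom (i : 'I_3) : C2C2C2 := (i != 0, i != 1, i != 2%:R).

Definition edge (e : Edge) : C2C2C2 * C2C2C2 :=
  match e with
  | inl i => (atom i, coatom i)
  | inr (m, true) => (atom (m + 1), atom (m + 2%:R))
  | inr (m, false) => (coatom (m + 2%:R), coatom (m + 1))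
  end.

(** True at the bottom element as well, which lies in no incomparable pair. *)
Definition is_atom (x : C2C2C2) : bool :=
  let: (a, b, c) := x in ~~ [|| a && b, a && c | b && c].

(* The coordinate that differs from the two others; a junk value on the bottom
   and top elements. *)
Definition odd_coord (x : C2C2C2) : 'I_3 :=
  let: (a, b, c) := x in if b == c then 0 else if a == c then 1 else 2%:R.

(** An atom and a coatom are incomparable only when their indices agree, so every other incomparable
    pair consists of two atoms or two coatoms. The final Boolean is the orientation relative to
    [edge]. *)
Definition edge_of (xy : C2C2C2 * C2C2C2) : Edge * bool :=
  let: (x, y) := xy in let i := odd_coord x in let j := odd_coord y in
  if i == j then (inl i, is_atom x)
  (* If {i, j} = {m + 1, m + 2}, then i + j = - m modulo 3. *)
  else (inr (- (i + j), is_atom x), (j == i + 1) == is_atom x).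

Definition arc (eb : Edge * bool) : C2C2C2 * C2C2C2 :=
  if eb.2 then edge eb.1 else ((edge eb.1).2, (edge eb.1).1).

Lemma forall_I3 (A : 'I_3 -> Prop) : A 0 -> A 1 -> A 2%:R -> forall i, A i.
Proof.
move=> A0 A1 A2 [[|[|[|//]]] lti].
- by rewrite (_ : Ordinal lti = 0) //; apply: val_inj.
- by rewrite (_ : Ordinal lti = 1) //; apply: val_inj.
- by rewrite (_ : Ordinal lti = 2%:R) //; apply: val_inj.
Qed.

Lemma arc_incomp eb : ((arc eb).1 >< (arc eb).2)%O.
Proof. by case: eb => [[i|[i []]] []]; elim/forall_I3: i. Qed.

Lemma arcK : cancel arc edge_of.
Proof. by case=> [[i|[i []]] []]; elim/forall_I3: i; apply/eqP. Qed.

Lemma edge_ofK xy : (xy.1 >< xy.2)%O -> arc (edge_of xy) = xy.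
Proof.
by case: xy => [[[[] []] []] [[[] []] []]] //= _; apply/eqP.
Qed.

Definition incomp_arc (eb : Edge * bool) : incomp C2C2C2 :=
  exist _ (arc eb) (arc_incomp eb).

Lemma incomp_arcK : cancel incomp_arc (fun a => edge_of (sval a)).
Proof. exact: arcK. Qed.

Lemma edge_of_incompK : cancel (fun a : incomp C2C2C2 => edge_of (sval a)) incomp_arc.
Proof. by move=> a; apply: val_inj; rewrite /= (edge_ofK _ (svalP a)). Qed.

Lemma incomp_arc_bij : bijective incomp_arc.
Proof. exact: Bijective incomp_arcK edge_of_incompK. Qed.

Lemma card_incomp_cube : #|{: incomp C2C2C2}| = 18%N.
Proof.
rewrite -(bij_eq_card incomp_arc_bij).
by rewrite card_prod card_sum card_prod card_ord card_bool.
Qed.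

Lemma arc_swap (e : Edge) (b : bool) :
  arc (e, ~~ b) = ((arc (e, b)).2, (arc (e, b)).1).
Proof. by rewrite /arc /=; case: b => //=; case: (edge e). Qed.

(** The strict relations between middle elements are [a_j < c_k] with [j] distinct from [k], so the
    common first element is [a_k] or [c_j]. The four shapes become the four interval bounds at [m]
    in [edge_polytope]. *)
Lemma arc_mono (eb fb : Edge * bool) :
  (arc eb).1 = (arc fb).1 -> ((arc eb).2 < (arc fb).2)%O ->
  exists m, [\/ eb = (inr (m, true), true) /\ fb = (inl (m + 1), true),
    eb = (inr (m, true), false) /\ fb = (inl (m + 2%:R), true),
    eb = (inl (m + 1), false) /\ fb = (inr (m, false), false)
    | eb = (inl (m + 2%:R), false) /\ fb = (inr (m, false), true)].
Proof.
(* In Boolean form, the 18 * 18 pairs of arcs are settled by computation. *)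
pose shape m := [|| (eb == (inr (m, true), true)) && (fb == (inl (m + 1), true)),
  (eb == (inr (m, true), false)) && (fb == (inl (m + 2%:R), true)),
  (eb == (inl (m + 1), false)) && (fb == (inr (m, false), false))
  | (eb == (inl (m + 2%:R), false)) && (fb == (inr (m, false), true))].
suff shapes : ((arc eb).1 == (arc fb).1) && ((arc eb).2 < (arc fb).2)%O ==>
    has shape [:: 0; 1; 2%:R].
  move=> /eqP eq1 lt2; move: shapes; rewrite eq1 lt2 => /hasP[m _ shape_m].
  by exists m; case/or4P: shape_m => /andP[/eqP -> /eqP ->]; constructor.
rewrite /shape {shape}.
by case: eb => [[i|[i []]] []]; elim/forall_I3: i;
  case: fb => [[j|[j []]] []]; elim/forall_I3: j.
Qed.

Definition cube_point {R : realType} (s : Edge -> R) : {ffun incomp C2C2C2 -> R} :=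
  [ffun a => let: (e, b) := edge_of (sval a) in if b then s e else 1 - s e].

Lemma cube_pointE {R : realType} (s : Edge -> R) e b :
  cube_point s (incomp_arc (e, b)) = if b then s e else 1 - s e.
Proof. by rewrite ffunE incomp_arcK. Qed.

Definition edge_polytope {R : realType} (s : Edge -> R) : Prop :=
  (forall i, s (inl i) <= 1) /\
  (forall m b, 1 - s (inl (m + 2%:R)) <= s (inr (m, b)) <= s (inl (m + 1))).

Lemma edge_polytope01 {R : realType} (s : Edge -> R) :
  edge_polytope s -> forall e, 0 <= s e <= 1.
Proof.
move=> [w1 itv] [i|[m b]]; last first.
  have /andP[lo hi] := itv m b; have := w1 (m + 1); have := w1 (m + 2%:R).
  by move: lo hi; lra.
(* The index [m = i + 2] makes [w_i] the upper end of an interval whose lower end is nonnegative. *)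
have im : i = i + 2%:R + 1 by elim/forall_I3: i; apply: val_inj.
have /andP[lo hi] := itv (i + 2%:R) true; have := w1 (i + 2%:R + 2%:R).
rewrite -im in hi; have := w1 i; move: lo hi; lra.
Qed.

Lemma prob_polytope_cubeP {R : realType} (x : {ffun incomp C2C2C2 -> R}) :
  prob_polytope R C2C2C2 x <-> exists s, edge_polytope s /\ x = cube_point s.
Proof.
split=> [/prob_polytopeP[itv compl mono]|[s [red_s ->]]].
  have flip e b : x (incomp_arc (e, ~~ b)) = 1 - x (incomp_arc (e, b)).
    have := compl (incomp_arc (e, b)) (incomp_arc (e, ~~ b)) (arc_swap e b).
    lra.
  exists (fun e => x (incomp_arc (e, true))); split; last first.
    apply/ffunP => a; rewrite -[a]edge_of_incompK; case: (edge_of _) => e b.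
    by rewrite cube_pointE; case: b => //; rewrite -flip.
  split=> [i|m b]; first by have /andP[] := itv (incomp_arc (inl i, true)).
  (* Each bound is one shape of [arc_mono]; reversed orientations are written [~~ true] so that
     [flip] applies. *)
  case: b; apply/andP; split.
  - have := mono (incomp_arc (inr (m, true), ~~ true))
      (incomp_arc (inl (m + 2%:R), true)) erefl.
    have -> : (atom (m + 1) < coatom (m + 2%:R))%O by elim/forall_I3: m.
    by rewrite flip => /(_ isT); lra.
  - apply: (mono (incomp_arc (inr (m, true), true))
      (incomp_arc (inl (m + 1), true)) erefl).
    by elim/forall_I3: m.
  - have := mono (incomp_arc (inl (m + 2%:R), ~~ true))
      (incomp_arc (inr (m, false), true)) erefl.
    rewrite flip; apply; by elim/forall_I3: m.
  - have := mono (incomp_arc (inl (m + 1), ~~ true))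
      (incomp_arc (inr (m, false), ~~ true)) erefl.
    have -> : (atom (m + 1) < coatom (m + 2%:R))%O by elim/forall_I3: m.
    by rewrite !flip => /(_ isT); lra.
apply/prob_polytopeP; split.
- move=> a; rewrite -[a]edge_of_incompK; case: (edge_of _) => e b.
  by rewrite cube_pointE; have := edge_polytope01 _ red_s e; case: b; lra.
- move=> a b; rewrite -[a]edge_of_incompK -[b]edge_of_incompK.
  case: (edge_of (sval a)) => e c; rewrite -(arc_swap e c) => /(can_inj arcK) ->.
  by rewrite !cube_pointE; case: c => /=; lra.
- move=> a b; rewrite -[a]edge_of_incompK -[b]edge_of_incompK.
  case: red_s => w1 itv.
  move=> /arc_mono arcs /arcs[m] {arcs}.
  have /andP[lo_t hi_t] := itv m true; have /andP[lo_f hi_f] := itv m false.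
  by case=> -[-> ->]; rewrite !cube_pointE; lra.
Qed.

(** * The list of vertices and the decomposition over it *)

(* The three summands index the vertices above w = (1,1,1), above w with
   w_i = 0, and above w = (1/2,1/2,1/2). *)
Notation VertexIndex :=
  ({ffun 'I_3 * bool -> bool} + 'I_3 * {ffun bool -> bool} + unit)%type.

(** Over the point with [w_i = 0], the interval at [m = i] is [0,1], while those at [i + 1] and
    [i + 2] are the points 1 and 0. *)
Definition vertex_coords {R : realType} (t : VertexIndex) (e : Edge) : R :=
  match t, e with
  | inl (inl eps), inl _ => 1
  | inl (inl eps), inr mb => (eps mb)%:R
  | inl (inr (i, del)), inl j => (j != i)%:R
  | inl (inr (i, del)), inr (m, b) => (if m == i then del b else m == i + 1)%:R
  | inr tt, _ => 2^-1
  end.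

Lemma edge_polytope_vertex_coords {R : realType} t : edge_polytope (@vertex_coords R t).
Proof.
case: t => [[eps|[i del]]|[]]; split=> /=; rewrite ?lexx //.
- by move=> m b; rewrite subrr ler0n lern1 leq_b1.
- by move=> j; rewrite lern1 leq_b1.
- move=> m b; elim/forall_I3: i; elim/forall_I3: m => /=; case: (del b) => /=; lra.
- by move=> i; lra.
- by move=> m b; lra.
Qed.

(** Reversed coordinates [1 - s e] make [cube_point] affine rather than linear, hence the total
    weight 1. *)
Lemma cube_point_convex_comb {R : realType} {T : finType} (w : T -> R)
    (s : T -> Edge -> R) :
  \sum_t w t = 1 ->
  cube_point (fun e => \sum_t w t * s t e) = [ffun a => \sum_t w t * cube_point (s t) a].
Proof.
move=> w1; apply/ffunP => a; rewrite -[a]edge_of_incompK [RHS]ffunE.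
case: (edge_of _) => e b; rewrite cube_pointE.
under [RHS]eq_bigr do rewrite cube_pointE.
case: b => //; under [RHS]eq_bigr do rewrite mulrBr mulr1.
by rewrite sumrB w1.
Qed.

Lemma sum_I3 {V : nmodType} (F : 'I_3 -> V) m :
  \sum_i F i = F m + F (m + 1) + F (m + 2%:R).
Proof.
rewrite !big_ord_recl big_ord0 addr0 addrA.
have -> : F ord0 + F (lift ord0 ord0) + F (lift ord0 (lift ord0 ord0)) =
    F 0 + F 1 + F 2%:R by congr (F _ + F _ + F _); apply: val_inj.
have addF (i j k : 'I_3) : val (i + j) = val k -> F (i + j) = F k by move/val_inj ->.
elim/forall_I3: m; first by rewrite !add0r.
  by rewrite (addF 1 1 2%:R) // (addF 1 2%:R 0) // [RHS]addrC [RHS]addrA.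
rewrite (addF 2%:R 1 0) // (addF 2%:R 2%:R 1) //.
by rewrite -[RHS]addrA [RHS]addrC.
Qed.

Lemma sum_vertex_index {R : realType} (F : VertexIndex -> R) :
  \sum_t F t = \sum_eps F (inl (inl eps)) +
    \sum_i \sum_del F (inl (inr (i, del))) + F (inr tt).
Proof.
rewrite big_sumType big_sumType /= pair_bigA; congr (_ + _ + _).
  by apply: eq_bigr => -[].
by rewrite (big_pred1 tt) // => -[].
Qed.

Lemma edge_polytope_vertex_decomposition {R : realType} (s : Edge -> R) :
  edge_polytope s -> exists w : VertexIndex -> R,
    [/\ forall t, 0 <= w t, \sum_t w t = 1
      & forall e, s e = \sum_t w t * vertex_coords t e].
Proof.
move=> red_s; have s01 := edge_polytope01 _ red_s; have [w1 itv] := red_s.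
pose d i := 1 - s (inl i).
(* The weights of (1/2,1/2,1/2), of the point with w_i = 0 and of (1,1,1) will be
   2 h, d_i - h and 1 - sd + h. *)
pose sd := \sum_i d i.
pose h := Num.max 0 (sd - 1).
have [h_ge0 h_ge] : 0 <= h /\ sd - 1 <= h by rewrite /h !le_max !lexx orbT.
(* This is [w_(m+1) + w_(m+2) >= 1]. With [d m >= 0] it puts [h] below every [d m], as nonnegativity
   of the weights [d_i - h] demands. *)
have sd_le m : sd - 1 <= d m.
  have /andP[lo hi] := itv m true.
  by rewrite /sd (sum_I3 d m) /d; move: lo hi; lra.
have h_le m : h <= d m.
  by rewrite ge_max sd_le andbT /d subr_ge0.
have h_le1 : 0 <= 1 - sd + h by move: h_ge; lra.
pose lo m := 1 - s (inl (m + 2%:R)); pose hi m := s (inl (m + 1)).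
(* A degenerate interval gives [t mb = 0], which is harmless. *)
pose t mb := (s (inr mb) - lo mb.1) / (hi mb.1 - lo mb.1).
have t01 mb : 0 <= t mb <= 1.
  case: mb => m b; have /andP[lo_s s_hi] := itv m b.
  have [hl|hl] := eqVneq (hi m) (lo m).
    by rewrite /t /= hl subrr invr0 mulr0 lexx ler01.
  have lt_lh : 0 < hi m - lo m.
    by rewrite subr_gt0 lt_neqAle eq_sym hl (le_trans lo_s s_hi).
  rewrite /t /= ler_pdivrMr // mul1r lerD2r s_hi andbT.
  by rewrite divr_ge0 ?(ltW lt_lh) // subr_ge0.
have sE m b : s (inr (m, b)) = t (m, b) * hi m + (1 - t (m, b)) * lo m.
  have [hl|hl] := eqVneq (hi m) (lo m).
    have /andP[lo_s s_hi] := itv m b.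
    rewrite hl -mulrDl addrC subrK mul1r; apply: le_anti.
    by apply/andP; split; [rewrite -hl|].
  by rewrite /t /=; field; rewrite subr_eq0.
exists (fun u => match u with
  | inl (inl eps) => (1 - sd + h) * product_weight t eps
  | inl (inr (i, del)) =>
      (d i - h) * product_weight (fun b => t (i, b)) del
  | inr tt => 2 * h
  end).
split.
- case=> [[eps|[i del]]|[]]; rewrite ?mulr_ge0 ?product_weight_ge0 ?subr_ge0 //.
- rewrite sum_vertex_index -mulr_sumr sum_product_weight.
  under eq_bigr do rewrite -mulr_sumr sum_product_weight mulr1.
  by rewrite sumrB sumr_const card_ord -/sd; ring.
have cst (J : finType) (u : J -> R) a c :
    \sum_eps a * product_weight u eps * c = a * c.
  by rewrite -mulr_suml -mulr_sumr sum_product_weight mulr1.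
have mrg (J : finType) (u : J -> R) a j :
    \sum_eps a * product_weight u eps * (eps j)%:R = a * u j.
  by under eq_bigr do rewrite -mulrA; rewrite -mulr_sumr product_weight_marginal.
case=> [j|[m b]]; rewrite sum_vertex_index /=.
  rewrite cst; under eq_bigr do rewrite cst.
  rewrite (sum_I3 _ j) eqxx.
  have [-> ->] : j != j + 1 /\ j != j + 2%:R.
    by split; elim/forall_I3: j.
  by rewrite /sd (sum_I3 d j) /d /=; field.
have [m1 m2 m3 m4] : [/\ (m == m + 1) = false, (m == m + 2%:R) = false,
    (m == m + 1 + 1) = false & m == m + 2%:R + 1].
  by split; elim/forall_I3: (m).
(* The points over (1,1,1) and over [w_m = 0] give [t (m, b)] the coefficient
   [1 - d_(m+1) - d_(m+2)], the interval length. Those over [w_(m+2) = 0] and the half point add up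
   to [d_(m+2)], the lower end. *)
rewrite mrg (sum_I3 _ m) eqxx m1 m2 m3 m4 mrg !cst sE /lo /hi /sd (sum_I3 d m) /d.
by rewrite /=; field.
Qed.

(** * The vertices of the cube's polytope *)

Definition vertex_point {R : realType} (t : VertexIndex) :
  {ffun incomp C2C2C2 -> R} := cube_point (vertex_coords t).

Lemma edge_polytope_convex_comb {R : realType} {T : finType} (w : T -> R)
    (s : T -> Edge -> R) :
  (forall t, 0 <= w t) -> \sum_t w t = 1 -> (forall t, edge_polytope (s t)) ->
  edge_polytope (fun e => \sum_t w t * s t e).
Proof.
move=> w_ge0 w1 red_s; rewrite /edge_polytope; split=> [i|m b].
  by rewrite -w1; apply: ler_sum => t _; rewrite ler_piMr //; case: (red_s t).
apply/andP; split.
  rewrite -[X in X - _]w1 -sumrB; apply: ler_sum => t _.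
  rewrite -[X in X - _]mulr1 -mulrBr ler_wpM2l //.
  by have [_ /(_ m b)/andP[]] := red_s t.
apply: ler_sum => t _; rewrite ler_wpM2l //.
by have [_ /(_ m b)/andP[]] := red_s t.
Qed.

Lemma prob_polytope_cube_hull {R : realType} :
  prob_polytope R C2C2C2 =
  convex_hull (fun k : 'I_#|{: VertexIndex}| => vertex_point (enum_val k)).
Proof.
apply/seteqP; split=> x.
  move/prob_polytope_cubeP => [s [red_s ->]]; apply/convex_hull_enum_valP.
  have [w [w_ge0 w1 sE]] := edge_polytope_vertex_decomposition _ red_s.
  exists w; split=> //; rewrite -cube_point_convex_comb //.
  by congr cube_point; apply/funext.
move/convex_hull_enum_valP => [w [w_ge0 w1 ->]]; apply/prob_polytope_cubeP.
exists (fun e => \sum_t w t * vertex_coords t e); split.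
  exact/edge_polytope_convex_comb/edge_polytope_vertex_coords.
by rewrite cube_point_convex_comb.
Qed.

Lemma cube_point_inj {R : realType} : injective (@cube_point R).
Proof.
move=> s s' eq_ss'; apply/funext => e.
have := congr1 (fun x : {ffun _} => x (incomp_arc (e, true))) eq_ss'.
by rewrite /= !cube_pointE.
Qed.

(** The [inl] coordinates return [w], which separates the three groups and determines [i]; the free
    interval coordinates then return the bits. *)
Lemma vertex_point_inj {R : realType} : injective (@vertex_point R).
Proof.
have half_nat (b : bool) : 2^-1 <> b%:R :> R by case: b => /=; lra.
have nat_inj (b c : bool) : b%:R = c%:R :> R -> b = c.
  by move/eqP; rewrite eqr_nat; case: b; case: c.
move=> t u /cube_point_inj eq_tu; have E e := congr1 (fun s => s e) eq_tu.
move: t u E {eq_tu} => [[eps|[i del]]|[]] [[eps'|[i' del']]|[]] E //.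
- by congr (inl (inl _)); apply/ffunP => mb; apply: nat_inj (E (inr mb)).
- by have := E (inl i'); rewrite /= eqxx => /eqP; rewrite oner_eq0.
- by have /esym/(half_nat true) := E (inl 0).
- by have := E (inl i); rewrite /= eqxx => /esym/eqP; rewrite oner_eq0.
- have /nat_inj := E (inl i); rewrite /= eqxx => /esym/negbFE/eqP eq_ii'.
  rewrite -{}eq_ii' in E *; congr (inl (inr (_, _))); apply/ffunP => b.
  by apply: nat_inj; have := E (inr (i, b)); rewrite /= eqxx.
- by have := E (inl i) => /esym/half_nat.
- by have /(half_nat true) := E (inl 0).
- by have := E (inl i') => /half_nat.
Qed.

Lemma card_vertex_index : #|{: VertexIndex}| = 77%N.
Proof.
rewrite card_sum card_sum card_unit [X in (_ + X + _)%N]card_prod !card_ffun.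
by rewrite card_prod !card_ord !card_bool.
Qed.

Lemma vertex_point_half {R : realType} : vertex_point (inr tt) = half_point R C2C2C2.
Proof.
apply/ffunP => a; rewrite -[a]edge_of_incompK [RHS]ffunE; case: (edge_of _) => e b.
by rewrite cube_pointE; case: b => //=; field.
Qed.

Lemma zero_one_vertex_point {R : realType} t :
  zero_one_point (@vertex_point R (inl t)).
Proof.
have coord01 e : exists b : bool, @vertex_coords R (inl t) e = b%:R.
  case: t e => [eps|[i del]] [j|[m b]] /=; first by exists true.
  - by exists (eps (m, b)).
  - by exists (j != i).
  - by exists (if m == i then del b else m == i + 1).
move=> a; rewrite -[a]edge_of_incompK; case: (edge_of _) => e b.
rewrite cube_pointE; have [c ->] := coord01 e.
by case: b c => [] [] /=; rewrite ?subrr ?subr0; auto.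
Qed.

Lemma half_point_vertex {R : realType} :
  vertices (prob_polytope R C2C2C2) (half_point R C2C2C2).
Proof.
pose c : {ffun incomp C2C2C2 -> R} :=
  [ffun a => if edge_of (sval a) is (inl _, true) then -1 else 0].
have dot_c s : dotp c (cube_point s) = - \sum_i s (inl i).
  rewrite /dotp (reindex incomp_arc) /=; last exact/onW_bij/incomp_arc_bij.
  pose G (e : Edge) (b : bool) := if (e, b) is (inl i, true) then - s (inl i) else 0.
  transitivity (\sum_(eb : Edge * bool) G eb.1 eb.2).
    apply: eq_bigr => -[e b] _; rewrite cube_pointE ffunE incomp_arcK.
    by case: e b => [i|mb] []; rewrite ?mulN1r ?mul0r.
  rewrite -(pair_bigA _ G) /= big_sumType /=.
  rewrite [X in _ + X]big1 => [|mb _]; last by rewrite big_bool /G /= addr0.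
  by rewrite addr0 -sumrN; apply: eq_bigr => i _; rewrite big_bool /G /= addr0.
(* A nonempty interval at [m] gives [w_(m+1) + w_(m+2) >= 1]. Adding the three instances bounds the
   sum of the [w_i] below by 3/2. *)
have le_half (s : Edge -> R) m : edge_polytope s -> s (inl m) <= \sum_i s (inl i) - 1.
  by move=> [_ itv]; rewrite (sum_I3 _ m); have /andP[] := itv m true; lra.
exists c, (- (3 / 2)); split.
  move=> x /prob_polytope_cubeP[s [red_s ->]]; rewrite dot_c.
  have := le_half s 0 red_s; have := le_half s (0 + 1) red_s.
  by have := le_half s (0 + 2%:R) red_s; rewrite (sum_I3 _ 0); lra.
apply/seteqP; split=> x.
  move->; rewrite -vertex_point_half; split.
    apply/prob_polytope_cubeP; exists (vertex_coords (inr tt)).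
    by split=> //; apply: edge_polytope_vertex_coords.
  by rewrite dot_c (sum_I3 _ 0) /=; field.
move=> [/prob_polytope_cubeP[s [red_s ->]]]; rewrite dot_c => sum_s.
(* At the minimum 3/2 each [w_m] is at most 1/2, so all equal 1/2, and every interval shrinks to the
   point 1/2. *)
have w_half m : s (inl m) = 2^-1.
  have := le_half s m red_s; have := le_half s (m + 1) red_s.
  have := le_half s (m + 2%:R) red_s; move: sum_s; rewrite (sum_I3 _ m); lra.
rewrite /= -vertex_point_half; congr cube_point; apply/funext => -[i|[m b]] //=.
have [_ /(_ m b)] := red_s; rewrite !w_half; lra.
Qed.

Lemma vertices_prob_polytope_cube {R : realType} :
  vertices (prob_polytope R C2C2C2) = range (@vertex_point R).
Proof.
apply/seteqP; split=> x; first rewrite prob_polytope_cube_hull.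
  by case/vertices_convex_hull_sub => t ->; exists t.
move=> [[t|[]] _ <-]; last by rewrite vertex_point_half; apply: half_point_vertex.
apply: zero_one_vertex; last exact: zero_one_vertex_point.
  by move=> y /prob_polytopeP[].
by rewrite prob_polytope_cube_hull; apply: convex_hull_enum_val_vertex.
Qed.

(** * Non-integrality, the function [nu], and the conclusion *)

Lemma half_notin_int {R : realType} : (2^-1 : R) \isn't a Num.int.
Proof.
apply/negP => /intrP[z half_z].
have : (2 * z)%:~R = 1%:~R :> R by rewrite intrM -half_z; field.
by move/intr_inj; lia.
Qed.

Lemma is_probability_function_nu {R : realType} {d : Order.disp_t}
    {P : finPOrderType d} : is_probability_function (nu R P).
Proof.
(* This is [nu] without its proof argument, so that case analysis on the order meets no dependent
   term. *)
pose n (x y : P) : R := if (x < y)%O then 1 else if (y < x)%O then 0 else 2^-1.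
have n_compl x y : x != y -> n x y + n y x = 1.
  by rewrite /n; case: (comparableP x y) => //= *; field.
have n_mono x y z : x != y -> x != z -> (y < z)%O -> n x y <= n x z.
  move=> xy xz yz; rewrite /n; case: (comparableP x y) xy => //= [xy|yx|xy] _.
  - by rewrite (lt_trans xy yz).
  - by case: ifP => _; [lra|case: ifP => _; lra].
  - case: (comparableP x z) xz => //= [_ _|zx _]; first lra.
    by rewrite /Order.comparable (ltW (lt_trans yz zx)) orbT in xy.
split=> [x y xy|x y xy|x y xy yx|x y z xy xz|x y z zx yx yz].
- by rewrite /nu; case: ifP => _; [lra|case: ifP => _; lra].
- by rewrite /nu le_eqVlt (negPf xy) => /= ->.
- exact: n_compl.
- exact: n_mono.
- have := n_mono x y z; rewrite !(eq_sym x) => /(_ yx zx yz).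
  by have := n_compl _ _ yx; have := n_compl _ _ zx; rewrite /n /nu; lra.
Qed.

Theorem mainTheorem3 (R : realType) :
  is_polytope (prob_polytope R C2C2C2) /\
  #|{: incomp C2C2C2}| = 18%N /\
  (vertices (prob_polytope R C2C2C2) #= `I_77)%card /\
  [set v | vertices (prob_polytope R C2C2C2) v /\ ~ zero_one_point v]
    = [set half_point R C2C2C2] /\
  is_probability_function (nu R C2C2C2) /\
  restrict_incomp (nu R C2C2C2) = half_point R C2C2C2 /\
  ~ zero_one_polytope (prob_polytope R C2C2C2) /\
  ~ lattice_polytope (prob_polytope R C2C2C2).
Proof.
pose a0 : incomp C2C2C2 := incomp_arc (inl 0, true).
have half_not01 : ~ zero_one_point (half_point R C2C2C2).
  by move/(_ a0); rewrite ffunE => -[]; lra.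
refine (conj _ (conj _ (conj _ (conj _ (conj _ (conj _ (conj _ _))))))).
- rewrite prob_polytope_cube_hull.
  by exists _, (fun k : 'I_#|{: VertexIndex}| => vertex_point (enum_val k)).
- exact: card_incomp_cube.
- rewrite vertices_prob_polytope_cube -card_vertex_index.
  pose f (k : 'I_#|{: VertexIndex}|) := @vertex_point R (enum_val k).
  have -> : range (@vertex_point R) = range f.
    apply/seteqP; split=> _ [t _ <-]; last by exists (enum_val t).
    by exists (enum_rank t) => //; rewrite /f enum_rankK.
  apply: card_eq_trans (inj_card_eq _) _.
    by move=> k l _ _ /vertex_point_inj/enum_val_inj.
  by rewrite card_eq_sym card_II.
- apply/seteqP; split=> x.
    rewrite vertices_prob_polytope_cube => -[[[t|[]] _ <-]] not01.
      by have := not01 (zero_one_vertex_point t).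
    by rewrite vertex_point_half.
  by move=> ->; split=> //; apply: half_point_vertex.
- exact: is_probability_function_nu.
- apply/ffunP => -[[x y] xy]; rewrite !ffunE /nu /=.
  by case: (comparableP x y) xy.
- by move=> [_ /(_ _ half_point_vertex)].
- move=> [_ /(_ _ half_point_vertex a0)]; rewrite ffunE.
  exact/negP/half_notin_int.
Qed.
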